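(* Let $\delta\ge 2$ be an integer and let $G$ be a connected graph of order $n\ge \max\{8\delta,\ \tfrac12\delta^2+2\delta+2\}$ with minimum degree $\delta$. If $$\lambda_1(D(G))\le \lambda_1\big(D(K_\delta\vee(K_{n-2\delta}+\delta K_1))\big),$$ then $G$ is 1-tough, unless $G\cong K_\delta\vee(K_{n-2\delta}+\delta K_1)$.
   Context: All graphs are finite, simple and undirected. For a connected graph $G$ with vertices $v_1,\dots,v_n$, the distance matrix $D(G)$ is the $n\times n$ matrix whose $(i,j)$-entry is the distance (length of a shortest path) between $v_i$ and $v_j$ (zero on the diagonal); $\lambda_1(D(G))$ denotes its largest eigenvalue, the distance spectral radius. $c(H)$ is the number of connected components of $H$. For $G\not\cong K_n$, the toughness is $\tau(G)=\min\{|S|/c(G-S): S\subseteq V(G)\text{ a vertex cut}\}$; $G$ is $t$-tough if $\tau(G)\ge t$. $K_m$ is the complete graph on $m$ vertices, $G_1+G_2$ is the disjoint union, $sH$ is the disjoint union of $s$ copies of $H$, and $G_1\vee G_2$ (join) is obtained from $G_1+G_2$ by adding all edges between $V(G_1)$ and $V(G_2)$. *)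

(* Defs.v *)
From HB Require Import structures.
From mathcomp Require Import all_boot all_order all_algebra.
From mathcomp Require Import reals.
Set Implicit Arguments. Unset Strict Implicit. Unset Printing Implicit Defensive.
Import Order.TTheory GRing.Theory Num.Theory.

Section Graphs.
Variable T : finType.
Variable e : rel T.

Definition simple_graph := symmetric e /\ irreflexive e.

Definition connected_graph := forall x y : T, connect e x y.

Definition degree (x : T) : nat := #|[set y | e x y]|.

Definition min_degree_is (d : nat) :=
  (exists x, degree x = d) /\ (forall x, d <= degree x).

Definition walk_of_len (k : nat) (x y : T) : bool :=
  [exists p : k.-tuple T, path e x p && (last x p == y)].

(* distance = length of a shortest path (= shortest walk); for a connected
   graph it is < #|T|, so searching in 0 .. #|T|-1 suffices. *)
Definition dist (x y : T) : nat :=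
  find (fun k => walk_of_len k x y) (iota 0 #|T|).

Definition dist_mx (R : nzRingType) : 'M[R]_#|T| :=
  \matrix_(i, j) ((dist (enum_val i) (enum_val j))%:R)%R.

Definition del_rel (S : {set T}) : rel T :=
  fun x y => [&& e x y, x \notin S & y \notin S].

Definition ncomp_del (S : {set T}) : nat := n_comp (del_rel S) (~: S).

Definition vertex_cut (S : {set T}) : bool := 2 <= ncomp_del S.

(* G is t-tough: tau(G) >= t, i.e. |S| / c(G-S) >= t for every vertex cut S
   (vacuous for complete graphs, matching tau(K_n) = infinity). *)
Definition t_tough (t : rat) : Prop :=
  forall S : {set T}, vertex_cut S -> (t * (ncomp_del S)%:R <= (#|S|)%:R)%R.

End Graphs.

Definition largest_eigenvalue (R : numFieldType) (m : nat) (A : 'M[R]_m) (l : R) : Prop :=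
  eigenvalue A l /\ (forall mu, eigenvalue A mu -> (mu <= l)%R).

Definition graph_iso (T1 T2 : finType) (e1 : rel T1) (e2 : rel T2) : Prop :=
  exists f : T1 -> T2, bijective f /\ forall x y, e1 x y = e2 (f x) (f y).

(* K_d \/ (K_{n-2d} + d K_1) on vertex set 'I_n:
   {0..d-1} = K_d, {d..n-d-1} = K_{n-2d}, {n-d..n-1} = the d isolated vertices
   of the union, all joined to K_d. *)
Definition extremal_rel (d n : nat) : rel 'I_n :=
  fun i j => (i != j) &&
    [|| (i < d)%N, (j < d)%N | ((d <= i < n - d) && (d <= j < n - d))%N].
Arguments extremal_rel d n : clear implicits.

(* Main.v *)
(** If [G] is not 1-tough, a cut [S] with [s = #|S|] splits the rest of [G] into at least
    [s + 1] parts with no edges between them; by the minimum degree each part has at least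
    [k + 1 - s] vertices, where [k = max(delta, s)].  Let [L - 1] be the distance spectral
    radius of the extremal graph.  The vector with values [wa], [wb], [wc] below satisfies all
    the distance eigenvalue equations of K_k v (K_(n-2k) + k K_1) for [L - 1] up to one common
    slack [charp n L k], which vanishes for [k = delta] and is positive for
    [delta < k <= n / 2].  Place the value [wa] on [S] and on [k - s] vertices of a largest part,
    [wc] on [k] vertices of the other parts, at most [k + 1 - s] in each, and [wb] elsewhere.
    Distances in [G] are at least 2 across parts, so the Rayleigh quotient of [G] at this vector
    is at least [L - 1], and every source of slack must vanish in the case of equality. *)
Require Import Defs.
From HB Require Import structures.
From mathcomp Require Import all_boot all_order all_algebra.
From mathcomp Require Import reals.
From mathcomp Require Import complex.
From mathcomp Require Import zify ring lra.
Import Order.TTheory GRing.Theory Num.Theory.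

(** * Walks and small distances *)

Lemma walk_of_len0 (T : finType) (e : rel T) (x y : T) : walk_of_len e 0 x y = (x == y).
Proof.
apply/existsP/eqP => [[p]|->]; first by rewrite tuple0 /= => /eqP.
by exists [tuple]; rewrite /= eqxx.
Qed.

Lemma walk_of_lenS (T : finType) (e : rel T) (k : nat) (x y : T) :
  walk_of_len e k.+1 x y = [exists z, e x z && walk_of_len e k z y].
Proof.
apply/existsP/existsP => [[p]|[z /andP[exz /existsP[p pP]]]].
  case/tupleP: p => z p /= /andP[/andP[exz pz] lst].
  by exists z; rewrite exz; apply/existsP; exists p; rewrite pz.
by exists [tuple of z :: p]; rewrite /= exz.
Qed.

Lemma walk_of_len_sym (T : finType) (e : rel T) (k : nat) (x y : T) :
  symmetric e -> walk_of_len e k x y = walk_of_len e k y x.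
Proof.
move=> sym_e; wlog suff: x y / walk_of_len e k x y -> walk_of_len e k y x.
  by move=> W; apply/idP/idP; exact: W.
case/existsP=> p /andP[px /eqP lst]; apply/existsP.
have szp : size (rev (belast x p)) == k by rewrite size_rev size_belast size_tuple.
exists (Tuple szp) => /=; rewrite -lst rev_path (@eq_path _ _ e) ?px; last first.
  by move=> u v; rewrite sym_e.
by case: (tval p) => //= z q; rewrite rev_cons last_rcons.
Qed.

Lemma dist_sym (T : finType) (e : rel T) (x y : T) :
  symmetric e -> dist e x y = dist e y x.
Proof. by move=> sym_e; apply: eq_find => k; rewrite walk_of_len_sym. Qed.

Lemma dist_le (T : finType) (e : rel T) (k : nat) (x y : T) :
  k < #|T| -> walk_of_len e k x y -> dist e x y <= k.
Proof.
move=> ltk walk; rewrite leqNgt; apply/negP => /(before_find 0).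
by rewrite nth_iota // add0n walk.
Qed.

(** If no walk is in range, [find] returns the length of the list, so [dist] defaults to [#|T|];
    hence the bound on [k]. *)
Lemma dist_ge (T : finType) (e : rel T) (k : nat) (x y : T) :
  k <= #|T| -> (forall j, j < k -> ~~ walk_of_len e j x y) -> k <= dist e x y.
Proof.
move=> lek no_walk; rewrite leqNgt; apply/negP => ltk.
have ltT : dist e x y < #|T| by exact: leq_trans lek.
have /(nth_find 0): has (fun j => walk_of_len e j x y) (iota 0 #|T|).
  by rewrite has_find size_iota.
rewrite -/(dist e x y) nth_iota // add0n => walk.
by have := no_walk _ ltk; rewrite walk.
Qed.

(** The left side is the distance truncated at 2, expressed through equality and adjacency only. *)
Lemma dist_ge_nonadj (T : finType) (e : rel T) (x y : T) :
  (x != y) + ((x != y) && ~~ e x y) <= dist e x y.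
Proof.
have [-> //|nxy] := eqVneq x y.
have T2 : 1 < #|T| by rewrite -cardsT (cardD1 x) (cardD1 y) !inE eq_sym nxy.
have [exy|nexy] := boolP (e x y) => /=; apply: dist_ge => //; first exact: ltnW.
  by case=> // _; rewrite walk_of_len0.
case=> [|[|//]] _; rewrite ?walk_of_len0 // walk_of_lenS.
by apply/existsP => -[z]; rewrite walk_of_len0 => /andP[exz /eqP zy]; rewrite -zy exz in nexy.
Qed.

(** Length 2 has to lie in the searched range [0 .. #|T| - 1], whence [2 < #|T|]. *)
Lemma dist_le_common (T : finType) (e : rel T) (x y : T) :
  2 < #|T| -> (x != y -> ~~ e x y -> exists z, e x z && e z y) ->
  dist e x y <= (x != y) + ((x != y) && ~~ e x y).
Proof.
move=> T3 common; have [->|nxy] := eqVneq x y.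
  by apply: dist_le; rewrite ?walk_of_len0 //; exact: ltn_trans T3.
have [exy|nexy] := boolP (e x y) => /=; apply: dist_le => //; first exact: ltnW.
  by rewrite walk_of_lenS; apply/existsP; exists y; rewrite exy walk_of_len0 eqxx.
have [z /andP[exz ezy]] := common nxy nexy.
rewrite walk_of_lenS; apply/existsP; exists z; rewrite exz /=.
by rewrite walk_of_lenS; apply/existsP; exists y; rewrite ezy walk_of_len0 eqxx.
Qed.

Lemma dist_mx_sym (R : nzRingType) (T : finType) (e : rel T) :
  symmetric e -> ((dist_mx e R)^T = dist_mx e R)%R.
Proof. by move=> sym_e; apply/matrixP => i j; rewrite !mxE dist_sym. Qed.

Local Open Scope ring_scope.

(** * Rayleigh quotients of the distance matrix *)

Lemma spectral_diag_eigenvalue (C : numClosedFieldType) (n : nat) (A : 'M[C]_n) (j : 'I_n) :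
  A \is normalmx -> eigenvalue A (spectral_diag A 0 j).
Proof.
move=> /orthomx_spectralP A_eq; set P := spectralmx A in A_eq.
have Pu : P \in unitmx by exact: spectral_unit.
apply/eigenvalueP; exists (row j P); last first.
  apply/eqP => /(congr1 (mulmx^~ (invmx P))); rewrite mul0mx -row_mul mulmxV //.
  by move=> /rowP /(_ j) /eqP; rewrite !mxE eqxx oner_eq0.
rewrite {1}A_eq -row_mul -mulmxA mulKVmx //.
by apply/rowP => k; rewrite row_mul row_diag_mx -scalemxAl -rowE !mxE.
Qed.

(** Over [R[i]] the matrix becomes Hermitian, hence unitarily diagonalizable with real spectrum.
    Each diagonal entry is then an eigenvalue of [A] over [R], so at most [l], and in spectral
    coordinates the form is a sum of these entries weighted by squared moduli. *)
Lemma rayleigh_le (R : rcfType) (n : nat) (A : 'M[R]_n) (l : R) (w : 'rV[R]_n) :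
  A^T = A -> largest_eigenvalue A l -> (w *m A *m w^T) 0 0 <= l * (w *m w^T) 0 0.
Proof.
move=> symA [_ l_max].
pose f : {rmorphism R -> R[i]} := real_complex R.
pose A' := map_mx f A; pose w' := map_mx f w.
have real_f m p (B : 'M[R]_(m, p)) : map_mx f B \is a mxOver Num.real.
  by apply/mxOverP => i j; rewrite mxE; apply/complex_realP; exists (B i j).
have hermA : A' \is hermsymmx.
  apply: realsym_hermsym; last exact: real_f.
  by apply/is_hermitianmxP; rewrite expr0 scale1r map_mx_id // /A' map_trmx symA.
have normA := hermitian_normalmx hermA.
set P := spectralmx A'; set d := spectral_diag A'.
have unitP : P \is unitarymx by exact: spectral_unitarymx.
have /orthomx_spectralP A_eq := normA; rewrite -/P -/d in A_eq.
have d_le j : d 0 j <= f l.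
  have /mxOverP/(_ 0 j)/complex_realP[m dm] := hermitian_spectral_diag_real hermA.
  have := @spectral_diag_eigenvalue _ _ A' j normA.
  rewrite -/d in dm *; rewrite dm lecR => eig_m; apply: l_max.
  by rewrite -(eigenvalue_map f).
rewrite -lecR -[real_complex R]/(f : R -> R[i]) rmorphM /=.
have -> : f ((w *m A *m w^T) 0 0) = (w' *m A' *m w'^T) 0 0.
  by rewrite /w' /A' map_trmx -!map_mxM [RHS]mxE.
have -> : f ((w *m w^T) 0 0) = (w' *m w'^T) 0 0.
  by rewrite /w' /A' map_trmx -!map_mxM [RHS]mxE.
pose z := w' *m invmx P.
have zT : P *m w'^T = (z ^t*)%sesqui.
  rewrite /z invmx_unitary // trmx_mul map_mxM trmxCK.
  by rewrite map_trmx ?realmxC ?real_f.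
have -> : w' *m A' *m w'^T = z *m diag_mx d *m (z ^t*)%sesqui.
  by rewrite {1}A_eq -zT /z !mulmxA.
have -> : w' *m w'^T = z *m (z ^t*)%sesqui.
  by rewrite -zT /z mulmxA mulmxKV // unitarymx_unit.
rewrite !mxE mulr_sumr ler_sum // => j _.
rewrite mul_mx_diag !mxE mulrAC mulrC ler_wpM2r ?mul_conjC_ge0 //.
Qed.

Lemma dist_mx_rayleigh (R : rcfType) (T : finType) (e : rel T) (l : R) (w : T -> R) :
  symmetric e -> largest_eigenvalue (dist_mx e R) l ->
  \sum_u \sum_v w u * w v * (dist e u v)%:R <= l * \sum_u w u ^+ 2.
Proof.
move=> sym_e lP; pose r : 'rV[R]_#|T| := \row_i w (enum_val i).
have := @rayleigh_le R _ _ l r (dist_mx_sym R T e sym_e) lP.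
have sumT (F : T -> R) : \sum_u F u = \sum_(i < #|T|) F (enum_val i).
  by rewrite -big_enum_val; apply: eq_bigl.
suff [-> ->] : (r *m dist_mx e R *m r^T) 0 0
      = \sum_u \sum_v w u * w v * (dist e u v)%:R
    /\ (r *m r^T) 0 0 = \sum_u w u ^+ 2 by [].
split; last by rewrite mxE sumT; apply: eq_bigr => i _; rewrite !mxE expr2.
rewrite exchange_big mxE sumT /=; apply: eq_bigr => j _.
rewrite !mxE mulr_suml sumT; apply: eq_bigr => i _.
by rewrite !mxE mulrAC.
Qed.

Lemma dist_mx_eigenfunction (R : fieldType) (T : finType) (e : rel T) (l : R) :
  eigenvalue (dist_mx e R) l ->
  exists2 x : T -> R, exists u, x u != 0 &
    forall v, \sum_u x u * (dist e u v)%:R = l * x v.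
Proof.
case/eigenvalueP => r rl r0; exists (fun u => r 0 (enum_rank u)).
  case/rV0Pn: r0 => i ri; exists (enum_val i); by rewrite enum_valK.
move=> v; have /rowP/(_ (enum_rank v)) := rl; rewrite !mxE => <-.
rewrite (reindex (@enum_val T predT)) /=; last exact/onW_bij/enum_val_bij.
by apply: eq_bigr => i _; rewrite !mxE enum_valK enum_rankK.
Qed.

(** * Distances and spectral radius of the extremal graph *)

Lemma extremal_sym (d n : nat) : symmetric (extremal_rel d n).
Proof.
move=> i j; rewrite /extremal_rel eq_sym; case: eqP => //= _.
by rewrite orbCA; congr [|| _, _ | _]; rewrite andbC.
Qed.

(** All distances are at most 2, and the products of indicators mark the pairs at distance 2. On the
    diagonal they leave [1 + C j], which the last term removes. This polynomial form reduces sums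
    over vertices to sums over the three classes. *)
Lemma dist_extremal (R : comNzRingType) (d n : nat) (i j : 'I_n) :
  (0 < d)%N -> (2 * d < n)%N ->
  let B (u : 'I_n) : R := (d <= u < n - d)%:R in
  let C (u : 'I_n) : R := (n - d <= u)%:R in
  (dist (extremal_rel d n) i j)%:R =
    1 + C i * B j + B i * C j + C i * C j - (i == j)%:R * (1 + C j) :> R.
Proof.
move=> d0 dn B C.
have n0 : (0 < n)%N by lia.
have -> : dist (extremal_rel d n) i j = ((i != j) + ((i != j) && ~~ extremal_rel d n i j))%N.
  apply/eqP; rewrite eqn_leq dist_ge_nonadj andbT.
  apply: dist_le_common => [|nij]; first by rewrite card_ord; lia.
  rewrite /extremal_rel nij /= !negb_or -!leqNgt => /and3P[di dj _].
  (* Vertex 0 lies in K_d, so it is a common neighbour. *)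
  exists (Ordinal n0); rewrite -!(inj_eq val_inj) /= d0 orbT /=.
  by apply/andP; split; lia.
have lt_nd u : (u < d)%N -> (n - d <= u)%N = false by lia.
rewrite /B /C /extremal_rel; have [<-|nij] := eqVneq i j => /=.
  rewrite ltnNge [in X in _ * X]leqNgt; have [] := leqP d i => id /=.
    by case: (_ <= _)%N => /=; ring.
  by rewrite (lt_nd _ id) /=; ring.
rewrite !ltnNge; have [di|id] := leqP d i; have [dj|jd] := leqP d j => /=;
  rewrite ?(lt_nd _ id) ?(lt_nd _ jd) /=; do 2?case: (_ <= _)%N => //=;
  ring.
Qed.

Lemma sum_ord_lt (R : pzRingType) (d n : nat) :
  (d <= n)%N -> \sum_(i < n) (i < d)%:R = d%:R :> R.
Proof.
move=> dn; rewrite -natr_sum; congr _%:R.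
suff -> : (\sum_(i < n) (i < d)%N = minn n d)%N by lia.
by elim: n {dn} => [|n IH]; rewrite ?big_ord0 ?big_ord_recr /= ?IH; lia.
Qed.

Lemma extremal_eigenvalue (R : rcfType) (d n : nat) (l : R) :
  (0 < d)%N -> (8 * d <= n)%N ->
  largest_eigenvalue (dist_mx (extremal_rel d n) R) l ->
  let L := l + 1 in
  n%:R ^+ 2 + 2 * d%:R * n%:R - 3 * d%:R ^+ 2 - d%:R <= n%:R * L /\
  L * (L + 1) * (n%:R - d%:R - L) + d%:R * (2 * L - d%:R) * (L + n%:R - 2 * d%:R) = 0.
Proof.
move=> d0 dn8 lP L; have dn : (2 * d < n)%N by lia.
pose A (u : 'I_n) : R := (u < d)%:R.
pose B (u : 'I_n) : R := (d <= u < n - d)%:R.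
pose C (u : 'I_n) : R := (n - d <= u)%:R.
have ABC u : A u + B u + C u = 1.
  rewrite /A /B /C [in X in _ + X]leqNgt; case: (leqP d u) => du /=.
    by case: (u < n - d)%N; rewrite /= ?add0r ?addr0.
  by rewrite (_ : (u < n - d)%N) /= ?addr0 //; lia.
have BC u : B u * C u = 0.
  by rewrite /B /C [in X in _ * X]leqNgt; case: (u < n - d)%N; rewrite ?andbF ?mul0r ?mulr0.
have AC u : A u * C u = 0.
  by rewrite /A /C; case: (ltnP u d) => ud; rewrite ?mul0r // leqNgt (_ : (u < n - d)%N) ?mulr0 //; lia.
have BB u : B u * B u = B u by rewrite /B; case: (_ <= _ < _)%N; rewrite ?mulr0 ?mulr1.
have CC u : C u * C u = C u by rewrite /C; case: (_ <= _)%N; rewrite ?mulr0 ?mulr1.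
have sumA : \sum_u A u = d%:R by apply: sum_ord_lt; lia.
have sumC : \sum_u C u = d%:R.
  rewrite (eq_bigr (fun u : 'I_n => 1 - (u < n - d)%:R)); last first.
    by move=> u _; rewrite /C leqNgt; case: (_ < _)%N; rewrite ?subrr ?subr0.
  rewrite big_split sumrN /= sumr_const card_ord sum_ord_lt ?leq_subr //.
  by rewrite natrB; [ring | lia].
have sumB : \sum_u B u = n%:R - 2 * d%:R.
  have : \sum_(u < n) (A u + B u + C u) = n%:R.
    by rewrite (eq_bigr _ (fun u _ => ABC u)) sumr_const card_ord.
  by rewrite !big_split /= sumA sumC; lra.
have mul_dist (x : 'I_n -> R) v : \sum_u x u * (dist (extremal_rel d n) u v)%:R =
    \sum_u x u + (\sum_u x u * C u) * B v + (\sum_u x u * B u) * C v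
    + (\sum_u x u * C u) * C v - x v * (1 + C v).
  have -> : x v * (1 + C v) = \sum_u x u * (u == v)%:R * (1 + C v).
    rewrite (bigD1 v) //= eqxx mulr1 big1 ?addr0 // => u /negbTE ->.
    by rewrite mulr0 mul0r.
  rewrite !mulr_suml -!big_split -sumrB /=; apply: eq_bigr => u _.
  by rewrite dist_extremal // -/(B u) -/(B v) -/(C u) -/(C v); ring.
have n0 : 0 < n%:R :> R by rewrite ltr0n; lia.
(* Rayleigh quotient at the all-ones vector: the distances add up to n(n - 1) plus the number of
   ordered nonadjacent pairs. *)
have rayl : n%:R ^+ 2 + 2 * d%:R * n%:R - 3 * d%:R ^+ 2 - d%:R <= n%:R * L.
  have := dist_mx_rayleigh _ _ _ _ (fun=> 1) (extremal_sym d n) lP.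
  rewrite [X in _ <= l * X](eq_bigr (fun=> 1)) => [|u _]; last by rewrite expr1n.
  rewrite sumr_const card_ord exchange_big /=.
  have -> : \sum_(v < n) \sum_(u < n) 1 * 1 * (dist (extremal_rel d n) u v)%:R =
     n%:R ^+ 2 + 2 * d%:R * n%:R - 3 * d%:R ^+ 2 - d%:R - n%:R :> R.
    under eq_bigr => v _ do rewrite mul1r mul_dist.
    under [\sum_u 1 * C u]eq_bigr => u _ do rewrite mul1r.
    under [\sum_u 1 * B u]eq_bigr => u _ do rewrite mul1r.
    rewrite sumrB !big_split /= -!mulr_sumr big_split /= sumB sumC.
    by rewrite !sumr_const card_ord -(mulr_natr n%:R); ring.
  by rewrite /L; lra.
split=> //.
have dR : 1 <= d%:R :> R by rewrite ler1n.
have dnR : 8 * d%:R <= n%:R :> R by rewrite -natrM ler_nat.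
have L0 : 0 < L.
  rewrite -(pmulr_rgt0 _ n0); apply: lt_le_trans rayl.
  have : 0 <= (n%:R - 8 * d%:R) * n%:R :> R by apply: mulr_ge0; lra.
  have : 0 <= (n%:R - 8 * d%:R) * d%:R :> R by apply: mulr_ge0; lra.
  have : 0 <= (d%:R - 1) * d%:R :> R by apply: mulr_ge0; lra.
  by lra.
have [eig _] := lP; have [x [u0 xu0] xP] := dist_mx_eigenfunction _ _ _ _ eig.
(* The eigenvector need not be constant on the classes, so the linear system is derived for its
   class sums. *)
pose X := \sum_u x u * A u; pose Y := \sum_u x u * B u; pose Z := \sum_u x u * C u.
have sumx : \sum_u x u = X + Y + Z.
  rewrite -!big_split; apply: eq_bigr => u _ /=.
  by rewrite -!mulrDr ABC mulr1.
have xE v : L * x v = X + Y + Z + Z * B v + Y * C v + Z * C v - x v * C v.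
  by have := xP v; rewrite mul_dist sumx -/Y -/Z /L; lra.
have AB u : A u * B u = 0.
  by rewrite /A /B; case: (ltnP u d) => ud; rewrite ?mul0r // mulr0.
have eqX : L * X = d%:R * (X + Y + Z).
  rewrite -sumA mulr_sumr mulr_suml; apply: eq_bigr => u _; move: (xE u) (AB u) (AC u).
  rewrite mulrA => -> ABu ACu.
  have -> : (X + Y + Z + Z * B u + Y * C u + Z * C u - x u * C u) * A u
    = A u * (X + Y + Z) + (A u * B u) * Z + (A u * C u) * (Y + Z - x u) by ring.
  by rewrite ABu ACu !mul0r !addr0.
have eqY : L * Y = (n%:R - 2 * d%:R) * (X + Y + 2 * Z).
  rewrite -sumB mulr_sumr mulr_suml; apply: eq_bigr => u _; move: (xE u) (BB u) (BC u).
  rewrite mulrA => -> BBu BCu.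
  have -> : (X + Y + Z + Z * B u + Y * C u + Z * C u - x u * C u) * B u
    = B u * (X + Y + Z) + (B u * B u) * Z + (B u * C u) * (Y + Z - x u) by ring.
  by rewrite BBu BCu; ring.
have eqZ : (L + 1) * Z = d%:R * (X + 2 * Y + 2 * Z).
  rewrite -sumC mulr_sumr mulr_suml; apply: eq_bigr => u _; move: (CC u) (BC u) => CCu BCu.
  have -> : (L + 1) * (x u * C u) = (L * x u + x u) * C u by ring.
  rewrite xE.
  have -> : (X + Y + Z + Z * B u + Y * C u + Z * C u - x u * C u + x u) * C u
    = C u * (X + Y + Z + x u) + (B u * C u) * Z + (C u * C u) * (Y + Z - x u) by ring.
  by rewrite CCu BCu; ring.
set h := (X in X = 0).
(* [- h] is the determinant of this linear system; the coefficients are its cofactors. *)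
pose m : R := n%:R - 2 * d%:R.
pose e1 := L * X - d%:R * (X + Y + Z).
pose e2 := L * Y - m * (X + Y + 2 * Z).
pose e3 := (L + 1) * Z - d%:R * (X + 2 * Y + 2 * Z).
have [e10 e20 e30] : [/\ e1 = 0, e2 = 0 & e3 = 0].
  by split; rewrite /e1 /e2 /e3 ?eqX ?eqY ?eqZ subrr.
have hX : h * X = 0.
  transitivity (- (((L - m) * (L + 1 - 2 * d%:R) - 4 * m * d%:R) * e1
    + d%:R * (L + 1) * e2 + d%:R * (L + m) * e3)); last by rewrite e10 e20 e30; ring.
  by rewrite /h /e1 /e2 /e3 /m; ring.
have hY : h * Y = 0.
  transitivity (- (m * (L + 1) * e1
    + ((L - d%:R) * (L + 1 - 2 * d%:R) - d%:R ^+ 2) * e2 + m * (2 * L - d%:R) * e3));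
    last by rewrite e10 e20 e30; ring.
  by rewrite /h /e1 /e2 /e3 /m; ring.
have hZ : h * Z = 0.
  transitivity (- (d%:R * (L + m) * e1 + d%:R * (2 * L - d%:R) * e2
    + ((L - d%:R) * (L - m) - d%:R * m) * e3)); last by rewrite e10 e20 e30; ring.
  by rewrite /h /e1 /e2 /e3 /m; ring.
(* If [h] were nonzero, all class sums would vanish and the eigenvalue equation would become
   [(L + C u) * x u = 0], forcing [x = 0] because [L > 0]. *)
apply/eqP; apply: contraT => h0.
have X0 : X = 0 by apply/eqP; move/eqP: hX; rewrite mulf_eq0 (negbTE h0).
have Y0 : Y = 0 by apply/eqP; move/eqP: hY; rewrite mulf_eq0 (negbTE h0).
have Z0 : Z = 0 by apply/eqP; move/eqP: hZ; rewrite mulf_eq0 (negbTE h0).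
have := xE u0; rewrite X0 Y0 Z0 => xe.
have /eqP : (L + C u0) * x u0 = 0 by lra.
by rewrite mulf_eq0 (negbTE xu0) orbF gt_eqF // ltr_pwDl.
Qed.

(** * Weights and their inequalities *)

(* Minus the characteristic polynomial, at [L - 1], of the 3 x 3 quotient of the distance matrix
   of K_k v (K_(n-2k) + k K_1). *)
Definition charp {R : pzRingType} (n L k : R) : R :=
  L * (L + 1) * (n - k - L) + k * (2 * L - k) * (L + n - 2 * k).

(* Perron vector of the distance matrix of K_k v (K_(n-2k) + k K_1) when [L - 1] is its
   spectral radius: [wa] on K_k, [wb] on K_(n-2k), [wc] on the isolated vertices. *)
Definition wa {R : pzRingType} (n L k : R) : R := L * (L + 1) - k * (L + n - 2 * k).
Definition wb {R : pzRingType} (L : R) : R := L * (L + 1).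
Definition wc {R : pzRingType} (n L k : R) : R := L * (L + n - 2 * k).

(** With chi the value of [charp], the weights satisfy [L * a = t - chi], [L * b = t + k * c - chi]
    and [(L + 1) * c = t + m * b + k * c - chi]. Multiplying by [k * a], [m * b], [k * c] and adding
    gives the identity, whose left side is the form of the distance matrix plus the identity
    matrix. *)
Lemma weights_identity (R : comPzRingType) (n L k : R) :
  let a := wa n L k in let b := wb L in let c := wc n L k in
  let m := n - 2 * k in let t := k * a + m * b + k * c in
  t ^+ 2 + 2 * (k * m * b * c) + k * (k - 1) * c ^+ 2
    = L * (k * a ^+ 2 + m * b ^+ 2 + k * c ^+ 2) + charp n L k * t.
Proof. by rewrite /wa /wb /wc /charp /=; ring. Qed.

Lemma weights_gt0 (R : realFieldType) (n L k : R) :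
  0 <= k -> 2 * k <= n -> n < L ->
  [/\ 0 < wa n L k, 0 < wb L, 0 < wc n L k & wc n L k < 2 * wb L].
Proof.
move=> k0 kn nL; have L0 : 0 < L by lra.
rewrite /wa /wb /wc; split.
- have : (2 * k) * ((L + n - 2 * k) / 2) <= L * L by apply: ler_pM; lra.
  by rewrite mulrDr mulr1; lra.
- by rewrite pmulr_rgt0 //; lra.
- by rewrite pmulr_rgt0 //; lra.
- by rewrite mulrCA ltr_pM2l //; lra.
Qed.

Lemma extremal_index_gt (R : realFieldType) (n L d : R) :
  2 <= d -> 8 * d <= n -> n ^+ 2 + 2 * d * n - 3 * d ^+ 2 - d <= n * L -> n + d + 1 <= L.
Proof.
move=> d2 dn nL; have n0 : 0 < n by lra.
(* After multiplication by [n], the difference is at least [(n - 8 * d) * (d - 1) + 5 * d * (d - 2)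
   + d]. *)
rewrite -(ler_pM2l n0).
have : 0 <= (n - 8 * d) * (d - 1) by apply: mulr_ge0; lra.
have : 0 <= (d - 2) * d by apply: mulr_ge0; lra.
by lra.
Qed.

Lemma weight_wc_lt_2wa (R : realFieldType) (n L d : R) :
  2 <= d -> 8 * d <= n -> n ^+ 2 + 2 * d * n - 3 * d ^+ 2 - d <= n * L ->
  wc n L d < 2 * wa n L d.
Proof.
move=> d2 dn nL; have dL := extremal_index_gt _ _ _ _ d2 dn nL.
have n0 : 0 < n by lra. have L0 : 0 < L by lra.
suff : 2 * d * (n - 2 * d) < L * (L + 2 - n) by rewrite /wc /wa; lra.
have dd : 0 < d * d by apply: mulr_gt0; lra.
have dn0 : 0 <= d * (n - 8 * d) by apply: mulr_ge0; lra.
(* By hypothesis [n * (L + 2 - n)] is at least [2 * n + 2 * d * n - 3 * d ^+ 2 - d]; the remaining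
   factor [L] is then bounded below by [n]. *)
rewrite -(ltr_pM2l n0); apply: (@lt_le_trans _ _ (L * (2 * n + 2 * d * n - 3 * d ^+ 2 - d))).
  apply: (@lt_le_trans _ _ (n * (2 * n + 2 * d * n - 3 * d ^+ 2 - d))).
    by rewrite ltr_pM2l //; lra.
  by rewrite ler_wpM2r //; lra.
by rewrite [leRHS]mulrCA ler_pM2l //; lra.
Qed.

Lemma charp_gt0 (R : realFieldType) (n L d k : R) :
  2 <= d -> 8 * d <= n -> n + d + 1 <= L -> d < k -> 2 * k <= n ->
  charp n L d = 0 -> 0 < charp n L k.
Proof.
move=> d2 dn dL dk kn hd; rewrite -[charp n L k]subr0 -[X in _ < _ - X]hd.
pose q := 2 * (k ^+ 2 + k * d + d ^+ 2) - (5 * L + n) * (k + d) + L * (L + 2 * n - 1).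
have -> : charp n L k - charp n L d = (k - d) * q by rewrite /charp /q; ring.
rewrite pmulr_rgt0 ?subr_gt0 //.
(* [q] decreases in [k], so the worst case is [k = n / 2]. *)
have -> : q = 2 * d ^+ 2 + L * (L - n / 2 - 5 * d - 1)
    + (n / 2 - k) * ((5 * L + n) - 2 * (k + n / 2) - 2 * d) by rewrite /q; field.
apply: ltr_wpDr; first by apply: mulr_ge0; lra.
(* The second factor is at least [n / 2 - 4 * d], which is where [8 * d <= n] enters. *)
apply: ltr_wpDr; first by apply: mulr_ge0; lra.
by rewrite pmulr_rgt0 // exprn_gt0 //; lra.
Qed.

(** * Quadratic forms over a partition *)

(** The right side collects the products of weights of distinct parts. Bounding the squares of the
    parts other than [i0] termwise by [ci <= f + 1] and [ei <= E] leaves the contribution of K_k v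
    (K_(n-2k) + k K_1), with [E + x] for n - 2k, plus two surplus terms. *)
Lemma parts_excess (R : realFieldType) (I : finType) (i0 : I) (W ci ei : I -> R)
    (a b c k f x E : R) :
  0 <= b -> 0 <= c ->
  W i0 = x * b + f * a -> (forall i, i != i0 -> W i = ci i * c + ei i * b) ->
  (forall i, i != i0 -> 0 <= ci i <= f + 1) -> (forall i, i != i0 -> 0 <= ei i) ->
  \sum_(i | i != i0) ci i = k -> \sum_(i | i != i0) ei i = E ->
  2 * (k * (E + x) * b * c) + k * (k - 1) * c ^+ 2
    + k * c * f * (2 * a - c) + 2 * E * b * (x * b + f * a - (f + 1) * c)
  <= (\sum_i W i) ^+ 2 - \sum_i W i ^+ 2.
Proof.
move=> b0 c0 W0 Wi ci_bd ei0 sum_c sum_e.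
have E_ge i : i != i0 -> ei i <= E.
  by move=> ni; rewrite -sum_e (bigD1 i) //= lerDl sumr_ge0 // => j /andP[/ei0].
rewrite (bigD1 i0) //= [\sum_i W i ^+ 2](bigD1 i0) //= W0.
have -> : \sum_(i | i != i0) W i = k * c + E * b.
  by rewrite (eq_bigr _ Wi) big_split /= -!mulr_suml sum_c sum_e.
have : \sum_(i | i != i0) W i ^+ 2
    <= (f + 1) * k * c ^+ 2 + 2 * (f + 1) * E * b * c + E ^+ 2 * b ^+ 2.
  have -> : (f + 1) * k * c ^+ 2 + 2 * (f + 1) * E * b * c + E ^+ 2 * b ^+ 2 =
    \sum_(i | i != i0) (ci i * ((f + 1) * c ^+ 2)
       + ei i * (2 * ((f + 1) * (b * c))) + ei i * (E * b ^+ 2)).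
    by rewrite !big_split /= -!mulr_suml sum_c sum_e; ring.
  apply: ler_sum => i ni; rewrite Wi //.
  have /andP[ci0 cif] := ci_bd i ni; have eii := ei0 i ni; have eE := E_ge i ni.
  have -> : (ci i * c + ei i * b) ^+ 2
    = ci i * (ci i * c ^+ 2) + ei i * (2 * (ci i * (b * c))) + ei i * (ei i * b ^+ 2) by ring.
  have bc0 : 0 <= b * c by exact: mulr_ge0.
  apply: lerD; first apply: lerD; rewrite ler_wpM2l // ?ler_wpM2r ?exprn_ge0 //.
  by rewrite ler_wpM2l // ler_wpM2r.
set Q := \sum_(i | _) _ => sq.
by rewrite -subr_ge0; move: sq; rewrite -subr_ge0; congr (_ <= _); ring.
Qed.

(** The bracket is the comparison matrix that bounds the distances from below. Its all-ones part
    minus the identity gives the first difference; the extra 1 across parts gives the second. *)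
Lemma parts_form (R : comNzRingType) (T I : finType) (S : {set T}) (p : T -> I) (w : T -> R) :
  let W i := \sum_(u | (u \notin S) && (p u == i)) w u in
  \sum_u \sum_v w u * w v *
      (1 - (u == v)%:R + [&& u \notin S, v \notin S & p u != p v]%:R)
    = (\sum_u w u) ^+ 2 - \sum_u w u ^+ 2 + ((\sum_i W i) ^+ 2 - \sum_i W i ^+ 2).
Proof.
move=> W; pose chi i u : R := ((u \notin S) && (p u == i))%:R.
have WE i : W i = \sum_u w u * chi i u.
  rewrite /W big_mkcond; apply: eq_bigr => u _.
  by rewrite /chi; case: (_ && _); rewrite ?mulr1 ?mulr0.
have sqE (x : T -> R) : (\sum_u x u) ^+ 2 = \sum_u \sum_v x u * x v.
  by rewrite expr2 big_distrlr.
have chi_sum u : \sum_i chi i u = (u \notin S)%:R.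
  rewrite (bigD1 (p u)) //= {1}/chi eqxx andbT big1 ?addr0 // => i ni.
  by rewrite /chi [p u == i]eq_sym (negbTE ni) andbF.
have chi_mul u v : \sum_i chi i u * chi i v = [&& u \notin S, v \notin S & p u == p v]%:R.
  rewrite (bigD1 (p u)) //= {1 2}/chi eqxx andbT big1 ?addr0 => [|i ni].
    by rewrite [p v == _]eq_sym; case: (_ \notin _); case: (_ \notin _); case: (_ == _); rewrite ?mulr0 ?mulr1.
  by rewrite /chi [p u == i]eq_sym (negbTE ni) andbF mul0r.
have -> : \sum_i W i = \sum_u w u * (u \notin S)%:R.
  rewrite (eq_bigr _ (fun i _ => WE i)) exchange_big; apply: eq_bigr => u _ /=.
  by rewrite -mulr_sumr chi_sum.
have -> : \sum_i W i ^+ 2 =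
    \sum_u \sum_v w u * w v * [&& u \notin S, v \notin S & p u == p v]%:R.
  under eq_bigr => i _ do rewrite WE sqE.
  rewrite exchange_big; apply: eq_bigr => u _ /=.
  rewrite exchange_big; apply: eq_bigr => v _ /=.
  by rewrite -chi_mul mulr_sumr; apply: eq_bigr => i _; rewrite mulrACA.
have -> : \sum_u w u ^+ 2 = \sum_u \sum_v w u * w v * (u == v)%:R.
  apply: eq_bigr => u _; rewrite (bigD1 u) //= eqxx mulr1 big1 ?addr0 ?expr2 // => v nv.
  by rewrite eq_sym (negbTE nv) mulr0.
rewrite !sqE -!sumrB -big_split; apply: eq_bigr => u _ /=.
rewrite -!sumrB -big_split; apply: eq_bigr => v _ /=.
by case: (_ \notin _); case: (_ \notin _); case: (_ == _); case: (_ == _) => /=; ring.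
Qed.

Lemma dist_ge_parts (R : numDomainType) (T I : finType) (e : rel T) (S : {set T})
    (p : T -> I) (u v : T) :
  (forall u v, u \notin S -> v \notin S -> e u v -> p u = p v) ->
  1 - (u == v)%:R + [&& u \notin S, v \notin S & p u != p v]%:R <= (dist e u v)%:R :> R.
Proof.
move=> pE; have := dist_ge_nonadj _ e u v; rewrite -(ler_nat R); apply: le_trans.
have [<-|nuv] := eqVneq u v; first by rewrite eqxx !andbF /= subrr addr0.
rewrite subr0 natrD lerD2l ler_nat /=.
by case: and3P => [[uS vS]|//]; case: (boolP (e u v)) => // /(pE _ _ uS vS) ->; rewrite eqxx.
Qed.

Lemma sum_three_values (R : pzRingType) (T : finType) (P : pred T) (X C : {set T}) (a b c : R) :
  [disjoint X & C] ->
  \sum_(u | P u) (if u \in X then a else if u \in C then c else b) =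
  #|[set u in X | P u]|%:R * a + #|[set u in C | P u]|%:R * c
   + (#|[set u | P u]|%:R - #|[set u in X | P u]|%:R - #|[set u in C | P u]|%:R) * b.
Proof.
move=> XC.
have card_sum (Y : pred T) (y : R) : #|[set u | Y u]|%:R * y = \sum_(u | Y u) y.
  by rewrite sumr_const mulr_natl cardsE.
have card_in (Y : {set T}) (y : R) :
    #|[set u in Y | P u]|%:R * y = \sum_(u | P u) (u \in Y)%:R * y.
  rewrite card_sum big_mkcondl [RHS]big_mkcond /= big_mkcond; apply: eq_bigr => u _.
  by case: (_ \in _); case: (P u); rewrite ?mul1r ?mul0r.
rewrite !mulrBl !card_in card_sum -!sumrB -!big_split /=; apply: eq_bigr => u _.
have := disjointFr XC (x := u); case: (u \in X) => [->|_] //; case: (u \in C) => /=;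
  rewrite ?mul1r ?mul0r ?subr0 ?addr0 ?add0r ?subrr ?addr0 //.
Qed.

Close Scope ring_scope.

(** * Parts of a cut and the choice of vertices *)

Lemma exists_subset_card (T : finType) (k : nat) (A : {set T}) :
  k <= #|A| -> exists2 B : {set T}, B \subset A & #|B| = k.
Proof.
move=> kA; exists [set x in take k (enum A)].
  by apply/subsetP => x; rewrite inE => /mem_take; rewrite mem_enum.
rewrite cardsE; have /card_uniqP -> : uniq (take k (enum A)) by rewrite take_uniq ?enum_uniq.
by rewrite size_take -cardE; case: ltngtP kA.
Qed.

(** The components are numbered by their roots and all those of index at least [k] are merged,
    giving exactly [k + 1] nonempty parts however many components there are. *)
Lemma ncomp_parts (T : finType) (e : rel T) (S : {set T}) (k : nat) :
  symmetric e -> k < ncomp_del e S ->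
  exists p : T -> 'I_k.+1,
    (forall u v, u \notin S -> v \notin S -> e u v -> p u = p v) /\
    (forall i, exists2 u, u \notin S & p u = i).
Proof.
move=> sym_e; rewrite /ncomp_del /n_comp_mem; set r := del_rel e S.
have sym_r : connect_sym r.
  by apply: sym_connect_sym => u v; rewrite /r /del_rel sym_e [(u \notin S) && _]andbC.
pose Q := [pred u | fingraph.root r u == u & u \in ~: S].
move=> kS; have kQ : k < #|Q| by exact: kS.
exists (fun u => inord (minn k (index (fingraph.root r u) (enum Q)))); split=> [u v uS vS uv|i].
  by rewrite (_ : fingraph.root r u = fingraph.root r v) //; apply/(fingraph.rootP sym_r)/connect1/and3P.
have szQ : i < size (enum Q) by rewrite -cardE; exact: leq_trans (ltn_ord i) kQ.
case: (pickP Q) => [u0 _|Q0]; last by rewrite (eq_card0 Q0) in kQ.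
have : nth u0 (enum Q) i \in Q by rewrite -mem_enum mem_nth.
case/andP=> /eqP rt; rewrite inE => uS; exists (nth u0 (enum Q) i) => //.
rewrite rt index_uniq ?enum_uniq //; have /minn_idPr -> : i <= k by rewrite -ltnS.
exact: inord_val.
Qed.

Lemma vertex_cut_neq0 (T : finType) (e : rel T) (S : {set T}) :
  symmetric e -> connected_graph e -> vertex_cut e S -> 0 < #|S|.
Proof.
move=> sym_e conn_e; rewrite card_gt0 => cutS; apply: contraL cutS => /eqP ->.
apply/negP => /(@ncomp_parts _ _ _ 1 sym_e)[p [pE p_onto]].
have p_const u v : connect e u v -> p u = p v.
  case/connectP => q; elim: q u => [u _ -> //|z q IH u /= /andP[euz pz] lst].
  by rewrite (pE u z) ?inE // (IH z).
have [u _ pu] := p_onto ord0; have [v _ pv] := p_onto ord_max.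
by have := p_const _ _ (conn_e u v); rewrite pu pv.
Qed.

(** All neighbours of [u] lie in [S] or in its own part; strictness comes from [u] itself, which is
    in the part but not a neighbour. *)
Lemma min_degree_part (T I : finType) (e : rel T) (S : {set T}) (p : T -> I) (u : T) :
  irreflexive e ->
  (forall u v, u \notin S -> v \notin S -> e u v -> p u = p v) ->
  u \notin S -> degree e u < #|S| + #|[set v | (v \notin S) && (p v == p u)]|.
Proof.
move=> irr_e pE uS; set P := [set v | _].
have uP : u \in P by rewrite inE uS eqxx.
rewrite (cardsD1 u P) uP addnCA add1n ltnS.
apply: leq_trans (leq_card_setU _ _); apply: subset_leq_card; apply/subsetP => v.
rewrite !inE => euv; case: (boolP (v \in S)) => //= vS.
rewrite (pE _ _ uS vS euv) eqxx andbT; apply: contraTneq euv => ->.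
by rewrite irr_e.
Qed.

Lemma sum_card_parts (T I : finType) (S Y : {set T}) (p : T -> I) :
  Y \subset ~: S -> \sum_i #|Y :&: [set v | (v \notin S) && (p v == i)]| = #|Y|.
Proof.
move=> /subsetP YS; rewrite -[RHS]sum1_card (partition_big p predT) //=.
apply: eq_bigr => i _; rewrite -sum1_card; apply: eq_bigl => u.
by rewrite !inE; case: (boolP (u \in Y)) => //= /YS; rewrite inE => ->.
Qed.

(** Fix [k + 1 - s] vertices in every part. The [s] parts other than [i0] then offer
    [s * (k + 1 - s)] of them, and this exceeds [k] by [(s - 1) * (k - s)], which is nonnegative;
    [C] is taken among them. *)
Lemma parts_selection (T : finType) (s k : nat) (S : {set T}) (p : T -> 'I_s.+1) (i0 : 'I_s.+1) :
  let P i := [set v | (v \notin S) && (p v == i)] in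
  0 < s <= k -> (forall i, k.+1 - s <= #|P i|) ->
  exists A C : {set T},
    [/\ A \subset P i0, #|A| = k - s, C \subset ~: (S :|: P i0), #|C| = k &
        forall i, #|C :&: P i| <= k.+1 - s].
Proof.
move=> P /andP[s0 sk] P_ge.
have [|A AP cardA] := @exists_subset_card _ (k - s) (P i0).
  by apply: leq_trans (P_ge i0); rewrite leq_sub2r.
have [f fP] : exists f : 'I_s.+1 -> {set T}, forall i, f i \subset P i /\ #|f i| = k.+1 - s.
  apply: (@fin_all_exists _ (fun=> {set T}) (fun i B => B \subset P i /\ #|B| = k.+1 - s)).
  by move=> i; have [B] := exists_subset_card _ _ _ (P_ge i); exists B.
pose B := [set u | (u \in f (p u)) && (p u != i0)].
have f_part i u : u \in f i -> (u \notin S) && (p u == i).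
  by have [/subsetP fi _] := fP i => /fi; rewrite inE.
have cardB : #|B| = s * (k.+1 - s).
  rewrite -sum1_card (partition_big p (fun i => i != i0)) => [|u]; last first.
    by rewrite inE => /andP[].
  rewrite (eq_bigr (fun=> k.+1 - s)) => [|i ni].
    by rewrite sum_nat_const cardC1 card_ord.
  have [_ <-] := fP i; rewrite -sum1_card; apply: eq_bigl => u; rewrite inE.
  have [->|npi] := eqVneq (p u) i; first by rewrite ni !andbT.
  by rewrite andbF; apply/esym; apply: contraNF npi => /f_part /andP[].
have [|C CB cardC] := @exists_subset_card _ k B; first by rewrite cardB; nia.
exists A, C; split=> //.
  apply/subsetP => u /(subsetP CB); rewrite !inE => /andP[/f_part/andP[uS _] pu].
  by rewrite (negbTE uS) (negbTE pu).
move=> i; have [_ <-] := fP i; apply: subset_leq_card; apply/subsetP => u.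
by rewrite !inE => /andP[/(subsetP CB)]; rewrite inE => /andP[fu _] /andP[_ /eqP <-].
Qed.

(** The isomorphism is the position in the list made of [S], then the remaining vertices, then
    [C]. *)
Lemma graph_iso_extremal (T : finType) (e : rel T) (d n : nat) (S C : {set T}) :
  #|T| = n -> #|S| = d -> #|C| = d -> [disjoint S & C] ->
  (forall u v, e u v =
    (u != v) && [|| u \in S, v \in S | (u \notin C) && (v \notin C)]) ->
  graph_iso e (extremal_rel d n).
Proof.
move=> cardT cardS cardC SC eE.
pose M := ~: (S :|: C); pose t := enum S ++ enum M ++ enum C.
have cardM : #|M| = n - d - d.
  by rewrite cardsCs setCK cardsU cardT cardS cardC disjoint_setI0 // cards0; lia.
have dn : d + d <= n.
  by rewrite -cardT -{1}cardS -cardC -cardsUI disjoint_setI0 // cards0 addn0 max_card.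
have idx_lt u : index u t < n.
  suff : index u t < size t.
    by rewrite !size_cat -!cardE cardS cardM cardC; lia.
  rewrite index_mem !mem_cat !mem_enum !inE.
  by case: (u \in S) => //=; case: (u \in C).
have idx_S u : (index u t < d) = (u \in S).
  rewrite index_cat mem_enum -cardE cardS; case: ifP => uS; last by lia.
  by rewrite -cardS cardE index_mem mem_enum.
have idx_C u : (index u t < n - d) = (u \notin C).
  rewrite index_cat mem_enum -cardE cardS; case: ifP => uS.
    have : index u (enum S) < d by rewrite -cardS cardE index_mem mem_enum.
    by rewrite (disjointFr SC uS); lia.
  rewrite index_cat mem_enum -cardE cardM inE !inE uS /=; case: ifP => uC; last by lia.
  have : index u (enum M) < n - d - d.
    by rewrite -cardM cardE index_mem mem_enum !inE uS.
  by lia.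
pose f u := Ordinal (idx_lt u); have f_inj : injective f.
  move=> u v [] /(congr1 (nth u t)); rewrite !nth_index // !mem_cat !mem_enum !inE.
    by case: (v \in S) => //=; case: (v \in C).
  by case: (u \in S) => //=; case: (u \in C).
exists f; split; first by apply: inj_card_bij => //; rewrite card_ord cardT.
move=> u v; rewrite eE /extremal_rel (inj_eq f_inj) /= ![d <= _]leqNgt !idx_S !idx_C.
by case: (u \in S); case: (v \in S).
Qed.

Local Open Scope ring_scope.

(** * The test vector *)

(** Here [f] is the size of [A], while [x] and [E] count the vertices of value [b] inside and
    outside [P i0], so the values [a], [b], [c] occur [k], [m = E + x] and [k] times. *)
Lemma parts_vector_ge (R : realFieldType) (T : finType) (s k : nat) (S A C : {set T})
    (p : T -> 'I_s.+1) (i0 : 'I_s.+1) (a b c : R) :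
  let P i := [set v | (v \notin S) && (p v == i)] in
  let w u := if u \in S :|: A then a else if u \in C then c else b in
  let m : R := #|T|%:R - 2 * k%:R in
  let f : R := k%:R - s%:R in
  let x : R := #|P i0|%:R - f in
  let E := m - x in
  0 <= b -> 0 <= c -> (s <= k)%N -> #|S| = s ->
  A \subset P i0 -> #|A| = (k - s)%N -> C \subset ~: (S :|: P i0) -> #|C| = k ->
  (forall i, #|C :&: P i| <= k.+1 - s)%N ->
  [/\ \sum_u w u = k%:R * a + m * b + k%:R * c,
      \sum_u w u ^+ 2 = k%:R * a ^+ 2 + m * b ^+ 2 + k%:R * c ^+ 2,
      E = \sum_(i | i != i0) (#|P i|%:R - #|C :&: P i|%:R) &
      2 * (k%:R * m * b * c) + k%:R * (k%:R - 1) * c ^+ 2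
        + k%:R * c * f * (2 * a - c) + 2 * E * b * (x * b + f * a - (f + 1) * c)
      <= (\sum_i \sum_(u in P i) w u) ^+ 2 - \sum_i (\sum_(u in P i) w u) ^+ 2].
Proof.
move=> P w m f x E b0 c0 sk cardS AP cardA CP cardC CPle.
have SA : S :&: A = set0.
  apply/setP => u; rewrite !inE; apply/negP => /andP[uS /(subsetP AP)].
  by rewrite inE uS.
have dXC : [disjoint S :|: A & C].
  rewrite disjoint_sym disjoints_subset; apply: (subset_trans CP).
  by rewrite setCS setUS.
have cardSA : #|S :|: A| = k by rewrite cardsU SA cards0 cardS cardA; lia.
have sum_all (a' b' c' : R) :
  \sum_u (if u \in S :|: A then a' else if u \in C then c' else b')
    = k%:R * a' + m * b' + k%:R * c'.
  rewrite (sum_three_values _ _ predT) //.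
  have setIdT (X : {set T}) : [set u in X | predT u] = X by apply/setP => u; rewrite !inE andbT.
  rewrite !setIdT cardSA cardC.
  have -> : [set u : T | predT u] = setT by apply/setP => u; rewrite !inE.
  by rewrite cardsT /m; ring.
have CS : C \subset ~: S by apply: subset_trans CP _; rewrite setCS subsetUl.
have CP0 : C :&: P i0 = set0.
  apply/setP => u; rewrite !inE; apply/negP => /andP[/(subsetP CP)].
  by rewrite !inE negb_or => /andP[_ /negbTE ->].
have sumC : \sum_(i | i != i0) #|C :&: P i|%:R = k%:R :> R.
  by rewrite -natr_sum -cardC -(sum_card_parts _ _ S C p) // [X in _ = X%:R](bigD1 i0) //= CP0 cards0 add0n.
have PS i : P i \subset ~: S by apply/subsetP => u; rewrite !inE => /andP[].
have sumP : #|P i0|%:R + \sum_(i | i != i0) #|P i|%:R = #|T|%:R - s%:R :> R.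
  rewrite -natr_sum -natrD; apply/eqP; rewrite eq_sym subr_eq -natrD; apply/eqP; congr _%:R.
  rewrite -(cardsC S) cardS addnC; congr (_ + _)%N.
  rewrite -(sum_card_parts _ _ S (~: S) p) // (bigD1 i0) //=; congr (_ + _)%N.
    by rewrite (setIidPr (PS i0)).
  by apply: eq_bigr => i _; rewrite (setIidPr (PS i)).
have EE : E = \sum_(i | i != i0) (#|P i|%:R - #|C :&: P i|%:R).
  by rewrite sumrB sumC /E /m /x /f; lra.
split=> //.
- exact: sum_all.
- rewrite -sum_all; apply: eq_bigr => u _.
  by rewrite /w; case: ifP => // _; case: ifP.
have -> : m = E + x by rewrite /E subrK.
have setPE i : [set u | u \in P i] = P i by apply/setP => u; rewrite inE.
apply: (parts_excess _ _ i0 _ (fun i => #|C :&: P i|%:R)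
          (fun i => #|P i|%:R - #|C :&: P i|%:R)) => //.
- rewrite sum_three_values // !setIdE !setPE CP0 cards0 setIUl (_ : S :&: P i0 = set0).
    by rewrite set0U (setIidPl AP) cardA natrB // /x /f; ring.
  by apply/setP => u; rewrite !inE; case: (u \in S).
- move=> i ni; rewrite sum_three_values // !setIdE !setPE setIUl (_ : S :&: P i = set0); last first.
    by apply/setP => u; rewrite !inE; case: (u \in S).
  rewrite set0U (_ : A :&: P i = set0) ?cards0; first by ring.
  apply/setP => u; rewrite !inE; apply/negP => /andP[/(subsetP AP)]; rewrite inE.
  by move=> /andP[_ /eqP ->] /andP[_]; rewrite eq_sym (negbTE ni).
- move=> i ni; rewrite ler0n /=; have := CPle i; rewrite -(ler_nat R) subSn // => h.
  by apply: le_trans h _; rewrite -natr1 natrB // /f.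
- by move=> i ni; rewrite subr_ge0 ler_nat subset_leq_card // subsetIr.
Qed.

Close Scope ring_scope.

(** * Sparse cuts and the case of equality *)

Lemma not_tough_cut (T : finType) (e : rel T) :
  t_tough e 1 \/ exists2 S : {set T}, vertex_cut e S & #|S| < ncomp_del e S.
Proof.
have [tough|/forallPn[S]] :=
    boolP [forall S : {set T}, vertex_cut e S ==> (ncomp_del e S <= #|S|)].
  by left=> S cutS; rewrite mul1r ler_nat; exact: (implyP (forallP tough S)).
by rewrite negb_imply -ltnNge => /andP[]; right; exists S.
Qed.

Lemma four_nonneg_sum_le0 (R : realDomainType) (x y z t : R) :
  (0 <= x -> 0 <= y -> 0 <= z -> 0 <= t -> x + y + z + t <= 0 ->
  [/\ x = 0, y = 0, z = 0 & t = 0])%R.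
Proof. by move=> x0 y0 z0 t0 le0; split; lra. Qed.

Lemma sparse_cut_graph_iso (R : rcfType) (T : finType) (e : rel T) (d n : nat) (l1 l2 : R)
    (S : {set T}) :
  simple_graph e -> connected_graph e -> #|T| = n -> 2 <= d -> 8 * d <= n ->
  d ^ 2 + 4 * d + 4 <= 2 * n -> (forall x, d <= degree e x) ->
  largest_eigenvalue (dist_mx e R) l1 ->
  largest_eigenvalue (dist_mx (extremal_rel d n) R) l2 ->
  (l1 <= l2)%R -> vertex_cut e S -> #|S| < ncomp_del e S ->
  graph_iso e (extremal_rel d n).
Proof.
move=> [sym_e irr_e] conn_e cardT d2 dn dn2 deg_ge l1P l2P l12 cutS sparse.
have s0 := vertex_cut_neq0 _ _ _ sym_e conn_e cutS.
have [p [pE p_onto]] := ncomp_parts _ _ _ _ sym_e sparse.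
set s := #|S| in s0 sparse p pE p_onto.
pose P i := [set v | (v \notin S) && (p v == i)].
have P_gt0 i : 0 < #|P i|.
  by have [u uS <-] := p_onto i; apply/card_gt0P; exists u; rewrite inE uS eqxx.
have P_deg i : d < s + #|P i|.
  have [u uS <-] := p_onto i.
  exact: leq_ltn_trans (deg_ge u) (min_degree_part _ _ _ _ _ _ irr_e pE uS).
pose k := maxn d s.
have sk : s <= k by exact: leq_maxr.
have dk : d <= k by exact: leq_maxl.
have k0 : 0 < k by exact: leq_trans s0 sk.
have kE : s < k -> k = d by rewrite /k; lia.
have P_ge i : k.+1 - s <= #|P i| by have := P_gt0 i; have := P_deg i; rewrite /k; lia.
have sumP : \sum_i #|P i| = n - s.
  rewrite -cardT -(cardsC S) addKn -(sum_card_parts _ _ _ _ p (subxx (~: S))).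
  apply: eq_bigr => i _; rewrite (setIidPr _) //.
  by apply/subsetP => u; rewrite !inE => /andP[].
have sn : s <= n by rewrite -cardT max_card.
pose i0 := [arg max_(i > ord0) #|P i|].
have P_max i : #|P i| <= #|P i0| by rewrite /i0; case: arg_maxnP => // j _; apply.
have sum_le : n - s <= s.+1 * #|P i0|.
  rewrite -sumP -[X in X * _]card_ord -sum_nat_const; exact: leq_sum.
have sum_ge : s.+1 <= n - s.
  by rewrite -sumP -[X in X <= _]card_ord -sum1_card; exact: leq_sum.
have kn : 2 * k <= n by rewrite /k; lia.
(* For [s < d] put [q = d - s]. If the largest part had at most [2 * q + 1] vertices, then
   [n <= 2 * s * q + 2 * d + 1], and [4 * s * q <= d ^ 2] would contradict the quadratic bound on
   [n]. For [s >= d] the only exception is that all parts are singletons. *)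
have P0_large : 2 * (k.+1 - s) <= #|P i0| \/ n = 2 * k + 1 /\ k = s /\ #|P i0| = 1.
  have [sd|ds] := ltnP s d.
    left; rewrite leqNgt; apply/negP => lt.
    have kd : k = d by rewrite /k; lia.
    have [q dE] : exists q, d = s + q by exists (d - s); lia.
    have {}lt : #|P i0| <= 2 * q + 1 by lia.
    have n_le : n - s <= s.+1 * (2 * q + 1) by apply: leq_trans sum_le _; rewrite leq_mul2l lt orbT.
    have sq : 2 * (s * q) <= s ^ 2 + q ^ 2 by exact: nat_Cauchy.
    have dd : d ^ 2 = s ^ 2 + q ^ 2 + 2 * (s * q) by rewrite dE sqrnD.
    have ss : s.+1 * (2 * q + 1) = 2 * (s * q) + s + 2 * q + 1 by lia.
    by lia.
  have ks : k = s by rewrite /k; lia.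
  move: (P_gt0 i0) sum_le; rewrite ks; case: #|P i0| => [//|[|q]] _ le; last by left; lia.
  by right; split; [lia | split].
have [|A [C [AP cardA CP cardC CPle]]] := parts_selection _ s k S p i0 _ P_ge.
  by rewrite s0.
pose L : R := (l2 + 1)%R.
have d_gt0 : 0 < d by lia.
have [rayl chi_d] := extremal_eigenvalue R d n l2 d_gt0 dn l2P.
rewrite -/L -/(charp n%:R L d%:R) in rayl chi_d.
have dR : (2 <= d%:R :> R)%R by rewrite ler_nat.
have dnR : (8 * d%:R <= n%:R :> R)%R by rewrite -natrM ler_nat.
have dL := extremal_index_gt _ _ _ _ dR dnR rayl.
have knR : (2 * k%:R <= n%:R :> R)%R by rewrite -natrM ler_nat.
have [a0 b0 c0 cb] : [/\ 0 < wa n%:R L k%:R, 0 < wb L, 0 < wc n%:R L k%:R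
    & wc n%:R L k%:R < 2 * wb L]%R.
  by apply: weights_gt0 => //; lra.
set a := wa _ _ _ in a0; set b := wb _ in b0 cb; set c := wc _ _ _ in c0 cb.
set chi_k := charp n%:R L k%:R.
have chi_gt0 : d < k -> (0 < chi_k)%R.
  by move=> ltdk; apply: charp_gt0 chi_d => //; rewrite ltr_nat.
have chi_ge0 : (0 <= chi_k)%R.
  by case: (ltngtP d k) dk => // [/chi_gt0/ltW //|dkE _]; rewrite /chi_k -dkE chi_d.
have ident := weights_identity R n%:R L k%:R.
rewrite /= -/a -/b -/c in ident.
have l2E : l2 = (L - 1)%R by rewrite /L addrK.
have c_lt_2a : s < k -> (c < 2 * a)%R.
  by move/kE=> kd; rewrite /a /c kd; exact: weight_wc_lt_2wa.
rewrite -/chi_k in ident; clearbody chi_k a b c L.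
pose m : R := (n%:R - 2 * k%:R)%R.
pose f : R := (k%:R - s%:R)%R.
pose x : R := (#|P i0|%:R - f)%R.
pose E : R := (m - x)%R.
pose w u := if u \in S :|: A then a else if u \in C then c else b.
have [sum_w sum_w2 EE excess] := parts_vector_ge R T s k S A C p i0 a b c (ltW b0) (ltW c0) sk
   (erefl s) AP cardA CP cardC CPle.
rewrite cardT -/w -/m -/f -/x -/E in sum_w sum_w2 EE excess.
pose D0 u v : R := (1 - (u == v)%:R + [&& u \notin S, v \notin S & p u != p v]%:R)%R.
have w_gt0 z : (0 < w z)%R by rewrite /w; case: ifP => // _; case: ifP.
have D0_le u v : (0 <= w u * w v * ((dist e u v)%:R - D0 u v))%R.
  apply: mulr_ge0; first by apply: mulr_ge0; exact: ltW.
  by rewrite subr_ge0; exact: dist_ge_parts.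
pose Gap := (\sum_u \sum_v w u * w v * ((dist e u v)%:R - D0 u v))%R.
have Gap_ge0 : (0 <= Gap)%R by apply: sumr_ge0 => u _; apply: sumr_ge0 => v _.
pose t := (k%:R * a + m * b + k%:R * c)%R.
have m_ge0 : (0 <= m)%R by rewrite /m subr_ge0.
have k_gt0 : (0 < k%:R :> R)%R by rewrite ltr0n.
have t_gt0 : (0 < t)%R.
  have ka : (0 < k%:R * a)%R by exact: mulr_gt0.
  have kc : (0 < k%:R * c)%R by exact: mulr_gt0.
  have mb : (0 <= m * b)%R by apply: mulr_ge0 => //; exact: ltW.
  by rewrite /t; lra.
have f_ge0 : (0 <= f)%R by rewrite subr_ge0 ler_nat.
have fa_gt0 : s < k -> (0 < f * (2 * a - c))%R.
  by move=> ltsk; rewrite mulr_gt0 ?subr_gt0 ?ltr_nat // c_lt_2a.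
have fa_ge0 : (0 <= f * (2 * a - c))%R.
  by case: (ltngtP s k) sk => // [/fa_gt0/ltW //|sE _]; rewrite /f -sE subrr mul0r.
have E_ge0 : (0 <= E)%R.
  by rewrite EE sumr_ge0 // => i _; rewrite subr_ge0 ler_nat subset_leq_card // subsetIr.
(* In the exceptional case [m = x = 1]. Otherwise [x >= f + 2], and the quantity equals [(x - (f +
   2)) * b + (f + 2) * (2 * b - c) / 2 + f * (2 * a - c) / 2]. *)
have E_gt0 : E = 0%R \/ (0 < x * b + f * a - (f + 1) * c)%R.
  case: P0_large => [P0_large|[nE [ks P1]]]; last first.
    by left; rewrite /E /m /x /f P1 nE ks natrD natrM; ring.
  right; have xf : (f + 2 <= x)%R.
    move: P0_large; rewrite -(ler_nat R) subSn // natrM -[(k - s).+1%:R%R]natr1 natrB // -/f /x; lra.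
  have h1 : (0 <= (x - (f + 2)) * b)%R by rewrite mulr_ge0 ?subr_ge0 // ltW.
  have h2 : (0 < (f + 2) * (2 * b - c))%R by rewrite mulr_gt0 ?subr_gt0 //; lra.
  by lra.
have Eb_ge0 : (0 <= 2 * E * b * (x * b + f * a - (f + 1) * c))%R.
  case: E_gt0 => [->|h]; first by rewrite mulr0 !mul0r.
  by rewrite !mulr_ge0 // ltW.
have kc_gt0 : (0 < k%:R * c)%R by rewrite mulr_gt0.
(* The form of the distance matrix at [w] is [Gap] plus that of [D0]. It is at most [(L - 1)] times
   the squared norm by the Rayleigh bound, and the form of [D0] is bounded below by [excess] and
   [ident]; the four surpluses remain. *)
have sum0 : (chi_k * t + k%:R * c * f * (2 * a - c)
    + 2 * E * b * (x * b + f * a - (f + 1) * c) + Gap <= 0)%R.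
  have w2_ge0 : (0 <= \sum_u w u ^+ 2)%R by apply: sumr_ge0 => u _; exact: sqr_ge0.
  have ray := dist_mx_rayleigh R T e l1 w sym_e l1P.
  have l12w : (l1 * \sum_u w u ^+ 2 <= l2 * \sum_u w u ^+ 2)%R by rewrite ler_wpM2r.
  have GapE : Gap = (\sum_u \sum_v w u * w v * (dist e u v)%:R
      - \sum_u \sum_v w u * w v * D0 u v)%R.
    rewrite -sumrB; apply: eq_bigr => u _; rewrite -sumrB; apply: eq_bigr => v _.
    by rewrite mulrBr.
  have form := parts_form R T _ S p w.
  have WE i : (\sum_(u | (u \notin S) && (p u == i)) w u = \sum_(u in P i) w u)%R.
    by apply: eq_bigl => u; rewrite inE.
  have W1 : (\sum_i \sum_(u | (u \notin S) && (p u == i)) w u = \sum_i \sum_(u in P i) w u)%R.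
    by apply: eq_bigr => i _; rewrite WE.
  have W2 : (\sum_i (\sum_(u | (u \notin S) && (p u == i)) w u) ^+ 2
      = \sum_i (\sum_(u in P i) w u) ^+ 2)%R.
    by apply: eq_bigr => i _; rewrite WE.
  rewrite /= W1 W2 in form.
  rewrite -/m -/t in ident.
  rewrite l2E in l12w; rewrite sum_w sum_w2 -/t in ray l12w form.
  lra.
(* The four vanishing terms give in turn [k = d], [k = s], [E = 0] (the parts other than [i0] lie in
   [C]), and distances equal to [D0]. *)
have [chi0 kcf0 Eb0 Gap0] : [/\ chi_k * t = 0, k%:R * c * f * (2 * a - c) = 0,
    2 * E * b * (x * b + f * a - (f + 1) * c) = 0 & Gap = 0]%R.
  have n1 : (0 <= chi_k * t)%R by rewrite mulr_ge0 // ltW.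
  have n2 : (0 <= k%:R * c * f * (2 * a - c))%R by rewrite -mulrA mulr_ge0 // ltW.
  exact: four_nonneg_sum_le0.
have kd : k = d.
  case: (ltngtP d k) dk => // /chi_gt0 h _.
  by have := mulr_gt0 h t_gt0; rewrite chi0 ltxx.
have ks : k = s.
  case: (ltngtP s k) sk => // /fa_gt0 h _.
  by have := mulr_gt0 kc_gt0 h; rewrite mulrA kcf0 ltxx.
have E0 : E = 0%R.
  case: E_gt0 => // h; apply/eqP; move/eqP: Eb0.
  by rewrite !mulf_eq0 (gt_eqF h) (gt_eqF b0) pnatr_eq0 /= !orbF.
have dist_eq u v : ((dist e u v)%:R = D0 u v)%R.
  have /eqP := Gap0; rewrite psumr_eq0 => [/allP/(_ u)|z _]; last exact: sumr_ge0.
  rewrite mem_index_enum => /(_ isT)/implyP/(_ isT).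
  rewrite psumr_eq0 => [/allP/(_ v)|z _]; last exact: D0_le.
  rewrite mem_index_enum => /(_ isT)/implyP/(_ isT).
  by rewrite !mulf_eq0 (gt_eqF (w_gt0 u)) (gt_eqF (w_gt0 v)) /= subr_eq0 => /eqP.
have P_sub i : i != i0 -> P i \subset C.
  move=> ni; have := EE; rewrite E0 => /esym/eqP.
  rewrite psumr_eq0 => [/allP/(_ i)|j _]; last by rewrite subr_ge0 ler_nat subset_leq_card // subsetIr.
  rewrite mem_index_enum => /(_ isT)/implyP/(_ ni).
  rewrite subr_eq0 eqr_nat => /eqP cardP.
  have /eqP <- : C :&: P i == P i by rewrite eqEcard subsetIr cardP /=.
  exact: subsetIl.
have C_S u : u \in C -> u \notin S /\ p u != i0.
  by move/(subsetP CP); rewrite !inE negb_or negb_and => /andP[uS]; rewrite uS.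
(* Since [k = s], each part meets [C] in at most one vertex, so the parts other than [i0] are
   singletons. *)
have C_inj u v : u \in C -> v \notin S -> p u = p v -> u = v.
  move=> uC vS puv; have [uS pu0] := C_S u uC.
  have vP : v \in P (p u) by rewrite inE vS puv eqxx.
  have vI : v \in C :&: P (p u) by rewrite in_setI (subsetP (P_sub _ pu0)).
  have uI : u \in C :&: P (p u) by rewrite !inE uC uS eqxx.
  have := CPle (p u); rewrite ks subSn // subnn => /card_le1_eqP le1.
  exact: le1.
have P0_out u : u \notin S -> u \notin C -> p u = i0.
  move=> uS; apply: contraNeq => /P_sub/subsetP; apply; by rewrite inE uS eqxx.
apply: (graph_iso_extremal _ _ _ _ S C) => //.
- by rewrite -/s -ks.
- by rewrite cardC.
- rewrite disjoint_sym disjoints_subset; apply: subset_trans CP _.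
  by rewrite setCS subsetUl.
move=> u v; have [<-|nuv] := eqVneq u v; first by rewrite irr_e.
(* Distinct vertices not separated by the parts have [D0] equal to 1, hence distance 1, hence are
   adjacent. *)
have adjP : e u v = ~~ [&& u \notin S, v \notin S & p u != p v].
  apply/idP/idP => [euv|].
    by apply/and3P => -[uS vS]; rewrite (pE _ _ uS vS euv) eqxx.
  move/negbTE => h; have := dist_eq u v; rewrite /D0 h (negbTE nuv) subr0 addr0 => /eqP.
  rewrite pnatr_eq1 => /eqP duv; have := dist_ge_nonadj _ e u v.
  by rewrite duv nuv; case: (e u v).
rewrite adjP !negb_and !negbK /=.
have [uS|uS] //= := boolP (u \in S); have [vS|vS] //= := boolP (v \in S).
apply/eqP/andP => [puv|[uC vC]]; last by rewrite !P0_out.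
split; apply: contra_neqN nuv => h; first exact: C_inj.
by apply/esym; apply: C_inj.
Qed.

Theorem theorem1p1 (R : realType) (T : finType) (e : rel T) (delta n : nat) :
  simple_graph e -> connected_graph e -> #|T| = n ->
  (2 <= delta)%N ->
  (8 * delta <= n)%N -> (delta ^ 2 + 4 * delta + 4 <= 2 * n)%N ->
  min_degree_is e delta ->
  forall l1 l2 : R,
    largest_eigenvalue (dist_mx e R) l1 ->
    largest_eigenvalue (dist_mx (extremal_rel delta n) R) l2 ->
    (l1 <= l2)%R ->
    t_tough e 1 \/ graph_iso e (extremal_rel delta n).
Proof.
move=> simple_e conn_e cardT d2 dn dn2 [_ deg_ge] l1 l2 l1P l2P l12.
have [tough|[S cutS sparse]] := not_tough_cut T e; first by left.
by right; exact: (sparse_cut_graph_iso R T e delta n l1 l2 S).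
Qed.
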